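(* Let $p\in[1,\infty)$, $q\in(1,\infty]$ and let $\{A_i\}_{i=1}^\infty$ be a sequence of $P$-operators with $\sup_i\|A_i\|_{p\to q}<\infty$. Then $\{A_i\}$ is action convergent if and only if for every $k\in\mathbb{N}$ the sequence $\{\mathcal{S}'_k(A_i)\}_{i=1}^\infty$ is convergent (Cauchy) in $d_H$.
   Context: A $P$-operator on a probability space $\Omega$ is a linear $A:L^\infty(\Omega)\to L^1(\Omega)$, $v\mapsto vA$, with $\|A\|_{\infty\to1}<\infty$, where $\|A\|_{p\to q}:=\sup_{v\in L^\infty(\Omega)}\|vA\|_q/\|v\|_p$. For measurable $v_1,\dots,v_k$ let $\mathcal{D}_A(v_1,\dots,v_k)$ be the joint distribution on $\mathbb{R}^{2k}$ of $(v_1,\dots,v_k,v_1A,\dots,v_kA)$. $\mathcal{S}_k(A)$ is the set of $\mathcal{D}_A(v_1,\dots,v_k)$ with $v_i$ measurable $\Omega\to[-1,1]$. A function partition is a family $v_1,\dots,v_k$ of $\{0,1\}$-valued measurable functions with $\sum_iv_i=1_\Omega$; $\mathcal{S}'_k(A)$ is the set of $\mathcal{D}_A(v_1,\dots,v_k)$ with $\{v_i\}$ a function partition. $d_H$ is the Hausdorff distance between sets of probability measures induced by the Lévy–Prokhorov metric. $\{A_i\}$ is action convergent if for each $k$, $\{\mathcal{S}_k(A_i)\}_i$ is Cauchy in $d_H$. *)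

(* Defs.v *)
From HB Require Import structures.
From mathcomp Require Import all_boot all_order all_algebra.
From mathcomp Require Import all_classical all_reals all_analysis.
Set Implicit Arguments. Unset Strict Implicit. Unset Printing Implicit Defensive.
Import Order.TTheory GRing.Theory Num.Theory.
Import numFieldNormedType.Exports.
Local Open Scope classical_set_scope.
Local Open Scope ring_scope.

Section PilotDefs.
Context {R : realType}.

Definition dist2 n (x y : 'I_n -> R) : R := Num.sqrt (\sum_(i < n) (x i - y i) ^+ 2).

Definition openE n (U : set ('I_n -> R)) : Prop :=
  forall x, U x -> exists2 e : R, 0 < e & forall y, dist2 x y < e -> U y.

Definition BorelE n : set (set ('I_n -> R)) := <<s [set U | openE U] >>.

Definition fatten n (U : set ('I_n -> R)) (e : R) : set ('I_n -> R) :=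
  [set x | exists2 y, U y & dist2 x y < e].

Definition dLP n {d1 d2} {T1 : measurableType d1} {T2 : measurableType d2}
  (P1 : probability T1 R) (X1 : T1 -> ('I_n -> R))
  (P2 : probability T2 R) (X2 : T2 -> ('I_n -> R)) : \bar R :=
  ereal_inf [set e%:E | e in [set e : R | 0 < e /\
    forall U, BorelE U ->
      (P1 (X1 @^-1` U) <= P2 (X2 @^-1` fatten U e) + e%:E)%E /\
      (P2 (X2 @^-1` U) <= P1 (X1 @^-1` fatten U e) + e%:E)%E]].

(** bounded measurable functions (representatives of L^infty) *)
Definition Linf {d} {T : measurableType d} (v : T -> R) : Prop :=
  measurable_fun setT v /\ exists M : R, forall x, `|v x| <= M.

(** P-operators: linear L^infty -> L^1 maps (on a.e.-classes) with finite
    infty->1 norm. *)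
Definition P_operator {d} {T : measurableType d} (P : probability T R)
  (A : (T -> R) -> (T -> R)) : Prop :=
  [/\ (forall v w (a b : R), Linf v -> Linf w ->
         {ae P, forall x, A (fun y => a * v y + b * w y) x = a * A v x + b * A w x}),
      (forall v w, Linf v -> Linf w -> {ae P, forall x, v x = w x} ->
         {ae P, forall x, A v x = A w x}),
      (forall v, Linf v -> measurable_fun setT (A v)) &
      exists C : R, forall v, Linf v ->
         (Lnorm P 1%E (EFin \o A v) <= C%:E * Lnorm P +oo%E (EFin \o v))%E].

Definition opnorm_le {d} {T : measurableType d} (P : probability T R)
  (p q : \bar R) (C : R) (A : (T -> R) -> (T -> R)) : Prop :=
  forall v, Linf v -> (Lnorm P q (EFin \o A v) <= C%:E * Lnorm P p (EFin \o v))%E.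

Definition jointv {T : Type} k (A : (T -> R) -> (T -> R)) (v : 'I_k -> T -> R)
  (x : T) : 'I_(k + k) -> R :=
  fun j => match fintype.split j with inl a => v a x | inr b => A (v b) x end.

Definition adm_S {d} {T : measurableType d} k (v : 'I_k -> T -> R) : Prop :=
  forall a, measurable_fun setT (v a) /\ forall x, `|v a x| <= 1.

Definition adm_S' {d} {T : measurableType d} k (v : 'I_k -> T -> R) : Prop :=
  (forall a, measurable_fun setT (v a) /\ forall x, v a x = 0 \/ v a x = 1) /\
  forall x, \sum_(a < k) v a x = 1.

(** Hausdorff distance (w.r.t. dLP) between the sets of distributions
    {D_A1(v) | adm v} and {D_A2(w) | adm w}. *)
Definition hausdorff k
  (adm : forall d (T : measurableType d), ('I_k -> T -> R) -> Prop)
  {d1 d2} {T1 : measurableType d1} {T2 : measurableType d2}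
  (P1 : probability T1 R) (A1 : (T1 -> R) -> (T1 -> R))
  (P2 : probability T2 R) (A2 : (T2 -> R) -> (T2 -> R)) : \bar R :=
  maxe
    (ereal_sup [set ereal_inf [set dLP P1 (jointv A1 v) P2 (jointv A2 w)
                               | w in [set w | adm _ _ w]]
               | v in [set v | adm _ _ v]])
    (ereal_sup [set ereal_inf [set dLP P1 (jointv A1 v) P2 (jointv A2 w)
                               | v in [set v | adm _ _ v]]
               | w in [set w | adm _ _ w]]).

Definition dH_cauchy
  (adm : forall k d (T : measurableType d), ('I_k -> T -> R) -> Prop)
  (dd : nat -> measure_display) (Om : forall i, measurableType (dd i))
  (P : forall i, probability (Om i) R) (A : forall i, (Om i -> R) -> (Om i -> R))
  : Prop :=
  forall k, (0 < k)%N -> forall e : R, 0 < e -> exists N, forall i j,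
    (N <= i)%N -> (N <= j)%N ->
    (hausdorff (adm k) (P i) (A i) (P j) (A j) < e%:E)%E.

Definition action_convergent (dd : nat -> measure_display)
  (Om : forall i, measurableType (dd i)) (P : forall i, probability (Om i) R)
  (A : forall i, (Om i -> R) -> (Om i -> R)) : Prop :=
  dH_cauchy (fun k d T => @adm_S d T k) P A.

Definition partition_convergent (dd : nat -> measure_display)
  (Om : forall i, measurableType (dd i)) (P : forall i, probability (Om i) R)
  (A : forall i, (Om i -> R) -> (Om i -> R)) : Prop :=
  dH_cauchy (fun k d T => @adm_S' d T k) P A.

End PilotDefs.

(* Main.v *)
(** The bound on the norms from [L^p] to [L^q] with [p] finite makes the
    operators uniformly continuous in measure: a function bounded by 2 that is
    small outside a small set has an image that is small outside a small set.
    Hence perturbing test functions in this sense perturbs their joint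
    distribution only slightly in the Lévy–Prokhorov metric, uniformly in [i].

    If a [[-1, 1]]-valued family on [Omega_j] has a joint distribution close to
    that of a function partition on [Omega_i], its values are near the vertices
    of the simplex with high probability, so rounding it to a function
    partition is such a perturbation.  Conversely, discretising a
    [[-1, 1]]-valued family along a finite grid is such a perturbation and
    exhibits it as a fixed linear combination of a function partition; matching
    this partition on [Omega_j] and applying the same linear combination, a
    Lipschitz map on joint distributions, matches the family. *)
From Pilot Require Import Defs.
From HB Require Import structures.
From mathcomp Require Import all_boot all_order all_algebra.
From mathcomp Require Import all_classical all_reals all_analysis.
From mathcomp Require Import measurable_realfun ring lra.
Import Order.TTheory GRing.Theory Num.Theory.
Local Open Scope classical_set_scope.
Local Open Scope ring_scope.

Set Implicit Arguments.
Unset Strict Implicit.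

Local Notation openE := Defs.openE.

(** * Euclidean distance and thickenings of sets *)

Section Dist2.
Context {R : realType} {n : nat}.
Implicit Types x y z : 'I_n -> R.

Lemma dist2_sqr x y : dist2 x y ^+ 2 = \sum_(i < n) (x i - y i) ^+ 2.
Proof. by rewrite sqr_sqrtr// sumr_ge0// => i _; rewrite sqr_ge0. Qed.

Lemma dist2_ge0 x y : 0 <= dist2 x y.
Proof. exact: sqrtr_ge0. Qed.

Lemma dist2_refl x : dist2 x x = 0.
Proof. by rewrite /dist2 big1 ?sqrtr0// => i _; rewrite subrr expr0n. Qed.

Lemma dist2_sym x y : dist2 x y = dist2 y x.
Proof. by congr Num.sqrt; apply: eq_bigr => i _; rewrite -sqrrN opprB. Qed.

Lemma ler_coord_dist2 x y i : `|x i - y i| <= dist2 x y.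
Proof.
rewrite -(ler_pXn2r (ltn0Sn 1)) ?nnegrE ?dist2_ge0// dist2_sqr.
rewrite (bigD1 i)//= real_normK ?num_real// lerDl.
by apply: sumr_ge0 => j _; rewrite sqr_ge0.
Qed.

Lemma ler_dist2_sum x y : dist2 x y <= \sum_(i < n) `|x i - y i|.
Proof.
rewrite -(ler_pXn2r (ltn0Sn 1)) ?nnegrE ?dist2_ge0 ?sumr_ge0// dist2_sqr.
rewrite expr2 mulr_suml; apply: ler_sum => i _.
rewrite -real_normK ?num_real// expr2 ler_wpM2l//.
by rewrite (bigD1 i)//= lerDl sumr_ge0.
Qed.

Lemma dist2_triangle x y z : dist2 x z <= dist2 x y + dist2 y z.
Proof.
have s0 := dist2_ge0 x y; have t0 := dist2_ge0 y z.
rewrite -(ler_pXn2r (ltn0Sn 1)) ?nnegrE ?addr_ge0 ?dist2_ge0//.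
set s := dist2 x y in s0 *; set t := dist2 y z in t0 *.
rewrite sqrrD !dist2_sqr.
have -> : \sum_(i < n) (x i - z i) ^+ 2 = \sum_(i < n) (x i - y i) ^+ 2
    + (\sum_(i < n) (x i - y i) * (y i - z i)) *+ 2
    + \sum_(i < n) (y i - z i) ^+ 2.
  rewrite -sumrMnl -!big_split/=; apply: eq_bigr => i _; ring.
rewrite lerD2r lerD2l lerMn2r/=.
(* Cauchy-Schwarz: if [s * t > 0], the defect times [2 * s * t] is the sum of the squares of
   [t * (x i - y i) - s * (y i - z i)]; if [s * t = 0], every product vanishes. *)
have [ts0|] := ltP 0 (s * t).
  rewrite -(ler_pM2l ts0) -(ler_pMn2r (ltn0Sn 1)) -subr_ge0.
  have -> : (s * t * (s * t)) *+ 2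
      - (s * t * \sum_(i < n) (x i - y i) * (y i - z i)) *+ 2 =
      \sum_(i < n) (t * (x i - y i) - s * (y i - z i)) ^+ 2.
    transitivity (t ^+ 2 * s ^+ 2 + s ^+ 2 * t ^+ 2
      - (s * t * \sum_(i < n) (x i - y i) * (y i - z i)) *+ 2); first by ring.
    rewrite {1}/s {2}/t !dist2_sqr !mulr_sumr -sumrMnl -sumrN -!big_split/=.
    by apply: eq_bigr => i _; rewrite -!dist2_sqr -/s -/t; ring.
  by apply: sumr_ge0 => i _; rewrite sqr_ge0.
rewrite le_eqVlt ltNge mulr_ge0// orbF => st0.
rewrite big1 ?mulr_ge0// => i _; move: st0; rewrite mulf_eq0 => /orP[]/eqP st.
  have := ler_coord_dist2 x y i; rewrite -/s st normr_le0 => /eqP ->.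
  by rewrite mul0r.
have := ler_coord_dist2 y z i; rewrite -/t st normr_le0 => /eqP ->.
by rewrite mulr0.
Qed.

Lemma sub_fatten (U : set ('I_n -> R)) e : 0 < e -> U `<=` fatten U e.
Proof. by move=> e0 x Ux; exists x; rewrite // dist2_refl. Qed.

Lemma fatten_le (U : set ('I_n -> R)) e e' :
  e <= e' -> fatten U e `<=` fatten U e'.
Proof. by move=> ee x [y Uy xy]; exists y => //; exact: lt_le_trans xy ee. Qed.

Lemma fatten_fatten (U : set ('I_n -> R)) e1 e2 :
  fatten (fatten U e1) e2 `<=` fatten U (e1 + e2).
Proof.
move=> x [y [z Uz yz] xy]; exists z => //.
by rewrite (le_lt_trans (dist2_triangle _ y _))// addrC ltrD.
Qed.

(** With [U] arbitrary, this makes every thickening Borel, as the events compared below must be. *)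
Lemma openE_fatten (U : set ('I_n -> R)) e : openE (fatten U e).
Proof.
move=> x [y Uy xy]; exists (e - dist2 x y); first by rewrite subr_gt0.
move=> z xz; exists y => //; rewrite (le_lt_trans (dist2_triangle _ x _))//.
by rewrite dist2_sym -ltrBrDr.
Qed.

Lemma BorelE_openE (U : set ('I_n -> R)) : openE U -> BorelE U.
Proof. exact: sub_sigma_algebra. Qed.

End Dist2.

(** * Borel sets and measurability of vector-valued maps *)

Lemma BorelE_preimage {R : realType} {m n : nat}
    (f : ('I_m -> R) -> ('I_n -> R)) (L : R) :
  0 < L -> (forall x y, dist2 (f x) (f y) <= L * dist2 x y) ->
  forall U, BorelE U -> BorelE (f @^-1` U).
Proof.
move=> L0 fL U BU.
suff : (image_set_system setT f (@BorelE R m)) U.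
  by rewrite /image_set_system/= setTI.
move: U BU; apply: smallest_sub.
  by apply: sigma_algebra_image; exact: smallest_sigma_algebra.
move=> U oU; rewrite /image_set_system/= setTI; apply: BorelE_openE => x /oU.
move=> [e e0 eU]; exists (e / L); first exact: divr_gt0.
by move=> y xy; apply/eU/(le_lt_trans (fL _ _)); rewrite mulrC -ltr_pdivlMr.
Qed.

(** A countable base of the topology: open cubes with rational centres. *)
Definition ratbox {R : realType} {n} (c : {ffun 'I_n -> rat} * nat) :
    set ('I_n -> R) :=
  [set y | forall i, `|y i - ratr (c.1 i)| < c.2.+1%:R^-1].

Lemma openE_ratbox {R : realType} {n} (U : set ('I_n -> R)) x :
  openE U -> U x -> exists c, ratbox c x /\ ratbox c `<=` U.
Proof.
move=> oU /oU [e e0 eU].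
(* Each of the [n] coordinates will contribute at most two radii to the distance from [x]; the
   successor keeps the denominator nonzero for [n = 0]. *)
have [m] : exists m, 0 + m.+1%:R^-1 < e / (n * 2).+1%:R.
  by apply: ltr_add_invr; rewrite divr_gt0.
rewrite add0r => me.
have h i : exists c : rat, `|x i - ratr c| < m.+1%:R^-1.
  have [|c] := @rat_in_itvoo R (x i - m.+1%:R^-1) (x i + m.+1%:R^-1).
    by rewrite ltrD2l gtrN// invr_gt0.
  by rewrite in_itv/= -ltr_distlC distrC => ?; exists c; rewrite distrC.
have [c xc] := choice h.
exists ([ffun i => c i], m); split; first by move=> i; rewrite /= ffunE.
move=> y yc; apply: eU; apply: le_lt_trans (ler_dist2_sum _ _) _.
apply: (@le_lt_trans _ _ (\sum_(i < n) (m.+1%:R^-1 *+ 2))).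
  apply: ler_sum => i _; rewrite (le_trans (ler_distD (ratr (c i)) _ _))//.
  have := yc i; rewrite /= ffunE => yci.
  by rewrite mulr2n lerD ?ltW// distrC.
rewrite sumr_const card_ord -mulrnA (mulnC 2) -[X in X < _]mulr_natr.
move: me; rewrite ltr_pdivlMr//; apply: le_lt_trans.
by rewrite ler_wpM2l ?invr_ge0// ler_nat.
Qed.

Section VectorMeasurability.
Context {R : realType} {d} {T : measurableType d} {n : nat}.
Variable X : T -> 'I_n -> R.
Hypothesis mX : forall i, measurable_fun setT (fun x => X x i).

Lemma measurable_ratbox c : measurable (X @^-1` ratbox c).
Proof.
have -> : X @^-1` ratbox c = \bigcap_(i in [set: 'I_n])
    (fun x => X x i) @^-1` [set t | `|t - ratr (c.1 i)| < c.2.+1%:R^-1].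
  by apply/seteqP; split => [x Xx i _|x Xx i]; [exact: Xx|exact: (Xx i I)].
apply: fin_bigcap_measurable => // i _; rewrite -[X in measurable X]setTI.
apply: mX => //; have -> : [set t | `|t - ratr (c.1 i)| < c.2.+1%:R^-1] =
    `](ratr (c.1 i) - c.2.+1%:R^-1), (ratr (c.1 i) + c.2.+1%:R^-1)[%classic :> set R.
  by apply/seteqP; split => t /=; rewrite in_itv/= ltr_distl.
exact: measurable_itv.
Qed.

(** The sets with measurable preimage form a σ-algebra. It contains each open set, which is a
    countable union of rational cubes. *)
Lemma measurable_preimage_BorelE U : BorelE U -> measurable (X @^-1` U).
Proof.
move=> BU; suff : (image_set_system setT X (@measurable d T)) U.
  by rewrite /image_set_system/= setTI.
move: U BU; apply: smallest_sub.
  by apply: sigma_algebra_image; exact: sigma_algebra_measurable.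
move=> U oU; rewrite /image_set_system/= setTI.
have -> : X @^-1` U =
    \bigcup_c (if `[< ratbox c `<=` U >] then X @^-1` ratbox c else set0).
  apply/seteqP; split => [x Ux|x [c _]].
    have [c [xc cU]] := openE_ratbox oU Ux.
    by exists c => //; rewrite (introT (asboolP _) cU).
  by case: asboolP => // cU Xc; exact: cU.
apply: countable_bigcupT_measurable => [|c]; first exact: countableP.
by case: asboolP => // _; exact: measurable_ratbox.
Qed.

End VectorMeasurability.

(** * Closeness in the Lévy-Prokhorov sense *)

Section LevyProkhorov.
Context {R : realType}.

Definition coord_measurable n d (T : measurableType d) (X : T -> 'I_n -> R) :=
  forall i, measurable_fun setT (fun x => X x i).

(** The condition on [e] under the infimum in [dLP], without positivity; using it directly avoids
    handling infima. *)
Definition LP_close n d1 d2 (T1 : measurableType d1) (T2 : measurableType d2)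
    (P1 : probability T1 R) (X1 : T1 -> 'I_n -> R)
    (P2 : probability T2 R) (X2 : T2 -> 'I_n -> R) (e : R) :=
  forall U, BorelE U ->
    (P1 (X1 @^-1` U) <= P2 (X2 @^-1` fatten U e) + e%:E)%E /\
    (P2 (X2 @^-1` U) <= P1 (X1 @^-1` fatten U e) + e%:E)%E.

Lemma measurable_fatten n d (T : measurableType d) (X : T -> 'I_n -> R) U e :
  coord_measurable X -> measurable (X @^-1` fatten U e).
Proof.
move=> mX; apply: measurable_preimage_BorelE => //.
by apply: BorelE_openE; exact: openE_fatten.
Qed.

Section Close.
Context n d1 d2 (T1 : measurableType d1) (T2 : measurableType d2)
  (P1 : probability T1 R) (X1 : T1 -> 'I_n -> R)
  (P2 : probability T2 R) (X2 : T2 -> 'I_n -> R).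

Lemma LP_close_sym e : LP_close P1 X1 P2 X2 e -> LP_close P2 X2 P1 X1 e.
Proof. by move=> c U /c[]. Qed.

Lemma LP_close_dLP e : 0 < e -> LP_close P1 X1 P2 X2 e ->
  (dLP P1 X1 P2 X2 <= e%:E)%E.
Proof. by move=> e0 c; apply: ereal_inf_lbound; exists e. Qed.

Hypotheses (mX1 : coord_measurable X1) (mX2 : coord_measurable X2).

Lemma LP_close_le e e' : e <= e' ->
  LP_close P1 X1 P2 X2 e -> LP_close P1 X1 P2 X2 e'.
Proof.
move=> ee c U /c[c1 c2]; split.
  apply: (le_trans c1); apply: leeD; rewrite ?lee_fin//.
  apply: le_measure; rewrite ?inE; try exact: measurable_fatten.
  by move=> x; exact: fatten_le.
apply: (le_trans c2); apply: leeD; rewrite ?lee_fin//.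
apply: le_measure; rewrite ?inE; try exact: measurable_fatten.
by move=> x; exact: fatten_le.
Qed.

Lemma dLP_lt_close e : (dLP P1 X1 P2 X2 < e%:E)%E -> LP_close P1 X1 P2 X2 e.
Proof.
move=> /ereal_inf_lt[_ [e' [_ c] <-]]; rewrite lte_fin => /ltW ee.
exact: LP_close_le ee c.
Qed.

(** The thickening by [e] of the preimage of [U] lies in the preimage of the thickening of [U] by
    [L * e]. As [1 <= L], the additive error [e] is also at most [L * e]. *)
Lemma LP_close_image m (f : ('I_n -> R) -> ('I_m -> R)) L e :
  1 <= L -> 0 <= e -> (forall x y, dist2 (f x) (f y) <= L * dist2 x y) ->
  coord_measurable (fun x => f (X1 x)) -> coord_measurable (fun x => f (X2 x)) ->
  LP_close P1 X1 P2 X2 e ->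
  LP_close P1 (fun x => f (X1 x)) P2 (fun x => f (X2 x)) (L * e).
Proof.
move=> L1 e0 fL m1 m2 c U BU.
have L0 : 0 < L by exact: lt_le_trans L1.
have sub (y : 'I_n -> R) : fatten (f @^-1` U) e y -> fatten U (L * e) (f y).
  move=> [z Uz yz]; exists (f z) => //; apply: le_lt_trans (fL _ _) _.
  by rewrite ltr_pM2l.
have eL : (e%:E <= (L * e)%:E)%E by rewrite lee_fin ler_peMl.
have [c1 c2] := c _ (BorelE_preimage L0 fL BU); split.
  apply: (le_trans c1); apply: leeD => //.
  apply: le_measure; rewrite ?inE; try exact: measurable_fatten.
  by move=> x; exact: sub.
apply: (le_trans c2); apply: leeD => //.
apply: le_measure; rewrite ?inE; try exact: measurable_fatten.
by move=> x; exact: sub.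
Qed.

End Close.

(** One closeness is applied to [U] and the other to the resulting thickening, which is open and
    hence Borel; the radii of nested thickenings add up. *)
Lemma LP_close_trans n d1 d2 d3 (T1 : measurableType d1)
    (T2 : measurableType d2) (T3 : measurableType d3)
    (P1 : probability T1 R) (X1 : T1 -> 'I_n -> R)
    (P2 : probability T2 R) (X2 : T2 -> 'I_n -> R)
    (P3 : probability T3 R) (X3 : T3 -> 'I_n -> R) e1 e2 :
  coord_measurable X1 -> coord_measurable X3 ->
  LP_close P1 X1 P2 X2 e1 -> LP_close P2 X2 P3 X3 e2 ->
  LP_close P1 X1 P3 X3 (e1 + e2).
Proof.
move=> m1 m3 c12 c23 U BU; split.
  have [c1 _] := c12 _ BU.
  have [c2 _] := c23 _ (BorelE_openE (openE_fatten (U := U) (e := e1))).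
  apply: (le_trans c1); rewrite EFinD [(e1%:E + e2%:E)%E]addeC addeA.
  apply: leeD => //; apply: (le_trans c2); apply: leeD => //.
  apply: le_measure; rewrite ?inE; try exact: measurable_fatten.
  by move=> x; exact: fatten_fatten.
have [_ c1] := c23 _ BU.
have [_ c2] := c12 _ (BorelE_openE (openE_fatten (U := U) (e := e2))).
apply: (le_trans c1); rewrite EFinD addeA.
apply: leeD => //; apply: (le_trans c2); apply: leeD => //.
apply: le_measure; rewrite ?inE; try exact: measurable_fatten.
by move=> x; rewrite addrC; exact: fatten_fatten.
Qed.

Lemma measurable_norm_ge d (T : measurableType d) (f : T -> R) c :
  measurable_fun setT f -> measurable [set x | c <= `|f x|].
Proof.
move=> mf; rewrite (_ : [set x | _] = (fun x => `|f x|) @^-1` `[c, +oo[%classic).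
  rewrite -[X in measurable X]setTI; have := measurableT_comp (@normr_measurable R setT) mf.
  by apply=> //; exact: measurable_itv.
by apply/seteqP; split => x /=; rewrite in_itv/= andbT.
Qed.

Lemma measure_fin_bigcup_le d (T : measurableType d) (P : {measure set T -> \bar R})
    (I : finType) (F : I -> set T) (e : R) :
  (forall i, measurable (F i)) -> (forall i, (P (F i) <= e%:E)%E) ->
  (P (\bigcup_i F i) <= (#|I|%:R * e)%:E)%E.
Proof.
move=> mF Fe.
have -> : \bigcup_i F i = \big[setU/set0]_(i <- enum I) F i.
  rewrite -bigcup_seq; apply: eq_bigcupl; split => // i _ /=.
  by rewrite mem_enum.
rewrite cardE; elim: (enum I) => [|i s IH].
  by rewrite big_nil measure0 mul0r.
rewrite big_cons /= -natr1 mulrDl mul1r addrC EFinD.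
apply: le_trans (leeD (Fe i) IH); apply: measureU2 => //.
exact: bigsetU_measurable.
Qed.

(** Off the union of the [n] exceptional events, which has probability at most [n * e], all
    coordinates differ by less than [e], so [X] and [Y] are less than [n * e] apart. *)
Lemma LP_close_coupling n d (T : measurableType d) (P : probability T R)
    (X Y : T -> 'I_n -> R) (e : R) :
  (0 < n)%N -> coord_measurable X -> coord_measurable Y ->
  (forall i, (P [set x | (e <= `|X x i - Y x i|)%R] <= e%:E)%E) ->
  LP_close P X P Y (n%:R * e).
Proof.
move=> n0 mX mY XY.
(* The hypothesis is symmetric in [X] and [Y], so one inequality suffices. *)
wlog suff H : X Y mX mY XY / forall U, BorelE U ->
    (P (X @^-1` U) <= P (Y @^-1` fatten U (n%:R * e)) + (n%:R * e)%:E)%E.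
  move=> U BU; split; first exact: H.
  apply: H => // i; rewrite (_ : [set x | _] = [set x | (e <= `|X x i - Y x i|)%R]).
    exact: XY.
  by apply/seteqP; split => x /=; rewrite distrC.
move=> U BU.
pose B i := [set x | e <= `|X x i - Y x i|].
have mB i : measurable (B i).
  by apply: measurable_norm_ge; exact: measurable_funB.
have mF : measurable (\bigcup_i B i) by exact: fin_bigcup_measurable.
have mYU := measurable_fatten U (n%:R * e) mY.
have mXU := measurable_preimage_BorelE mX BU.
apply: (@le_trans _ _ (P (Y @^-1` fatten U (n%:R * e)) + P (\bigcup_i B i))%E).
  apply: le_trans (measureU2 _ _ _) => //; apply: le_measure; rewrite ?inE//.
    exact: measurableU.
  move=> x Ux /=; have [xB|xB] := pselect ((\bigcup_i B i) x); [by right|left].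
  exists (X x) => //; have lt i : `|X x i - Y x i| < e.
    by rewrite ltNge; apply/negP => h; apply: xB; exists i.
  rewrite dist2_sym; apply: le_lt_trans (ler_dist2_sum _ _) _.
  rewrite -[n in X in _ < X]card_ord mulr_natl -sumr_const.
  (* A strict inequality of sums needs at least one index, hence [0 < n]. *)
  apply: ltr_sum => [|i _]; last exact: lt.
  by apply/hasP; exists (Ordinal n0); rewrite ?mem_index_enum.
by apply: leeD => //; rewrite -[n in X in (_ <= X)%E]card_ord; exact: measure_fin_bigcup_le.
Qed.

(** * Hausdorff distance and the Cauchy condition *)

Lemma hausdorff_lt k
    (adm : forall d (T : measurableType d), ('I_k -> T -> R) -> Prop)
    d1 d2 (T1 : measurableType d1) (T2 : measurableType d2)
    (P1 : probability T1 R) A1 (P2 : probability T2 R) A2 e v :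
  (hausdorff adm P1 A1 P2 A2 < e)%E -> adm _ _ v ->
  exists2 w, adm _ _ w & (dLP P1 (jointv A1 v) P2 (jointv A2 w) < e)%E.
Proof.
rewrite /hausdorff gt_max => /andP[h _] av.
have : (ereal_inf [set dLP P1 (jointv A1 v) P2 (jointv A2 w)
                  | w in [set w | adm _ _ w]] < e)%E.
  by apply: le_lt_trans h; apply: ereal_sup_ubound; exists v.
by move=> /ereal_inf_lt[_ [w aw <-]]; exists w.
Qed.

Lemma hausdorff_le k
    (adm : forall d (T : measurableType d), ('I_k -> T -> R) -> Prop)
    d1 d2 (T1 : measurableType d1) (T2 : measurableType d2)
    (P1 : probability T1 R) A1 (P2 : probability T2 R) A2 e :
  0 < e ->
  (forall v, adm _ _ v -> exists2 w, adm _ _ w &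
    LP_close P1 (jointv A1 v) P2 (jointv A2 w) e) ->
  (forall w, adm _ _ w -> exists2 v, adm _ _ v &
    LP_close P2 (jointv A2 w) P1 (jointv A1 v) e) ->
  (hausdorff adm P1 A1 P2 A2 <= e%:E)%E.
Proof.
move=> e0 h1 h2; rewrite /hausdorff ge_max; apply/andP; split.
  apply: ge_ereal_sup => _ [v /h1[w aw c] <-].
  by apply: ge_ereal_inf; exists (dLP P1 (jointv A1 v) P2 (jointv A2 w));
    [exists w|exact: LP_close_dLP].
apply: ge_ereal_sup => _ [w /h2[v av /LP_close_sym c] <-].
by apply: ge_ereal_inf; exists (dLP P1 (jointv A1 v) P2 (jointv A2 w));
  [exists v|exact: LP_close_dLP].
Qed.

(* The two halves of the Hausdorff distance are exchanged by [i <-> j], so one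
   of them suffices. *)
Lemma dH_cauchyP
    (adm : forall k d (T : measurableType d), ('I_k -> T -> R) -> Prop)
    (dd : nat -> measure_display) (Om : forall i, measurableType (dd i))
    (P : forall i, probability (Om i) R)
    (A : forall i, (Om i -> R) -> (Om i -> R)) :
  (forall i k v, adm k _ (Om i) v -> coord_measurable (jointv (A i) v)) ->
  dH_cauchy adm P A <->
  forall k, (0 < k)%N -> forall e : R, 0 < e -> exists N, forall i j,
    (N <= i)%N -> (N <= j)%N -> forall v, adm k _ _ v ->
    exists2 w, adm k _ _ w &
      LP_close (P i) (jointv (A i) v) (P j) (jointv (A j) w) e.
Proof.
move=> mA; split => h k k0 e e0.
  have [N hN] := h k k0 e e0; exists N => i j Ni Nj v av.
  have [w aw c] := hausdorff_lt (hN i j Ni Nj) av.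
  by exists w => //; apply: dLP_lt_close c; exact: mA.
(* Closeness bounds the Hausdorff distance only weakly; halving [e] restores strictness. *)
have [|N hN] := h k k0 (e / 2); first by rewrite divr_gt0.
exists N => i j Ni Nj; apply: (@le_lt_trans _ _ (e / 2)%:E).
  by apply: hausdorff_le; [rewrite divr_gt0|exact: hN|exact: hN].
by rewrite lte_fin ltr_pdivrMr// ltr_pMr// ltr1n.
Qed.

(** * Passing between norms and smallness in measure *)

Section SmallInMeasure.
Context d (T : measurableType d) (P : probability T R).

(** Pointwise [|u|^p <= s^p + 2^p 1_B], where [B] is the event [s <= |u|]. The integral is at most
    [s^p + 2^p s], and [s^p <= s] because [s <= 1 <= p]. *)
Lemma Lnorm_le_of_prob (p s k : R) (u : T -> R) :
  1 <= p -> 0 < s -> s <= 1 -> 0 <= k -> (1 + 2 `^ p) * s <= k `^ p ->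
  measurable_fun setT u -> (forall x, `|u x| <= 2) ->
  (P [set x | (s <= `|u x|)%R] <= s%:E)%E ->
  (Lnorm P p%:E (EFin \o u) <= k%:E)%E.
Proof.
move=> p1 s0 s1 k0 sk mu u2 Pu.
have p0 : 0 < p by exact: lt_le_trans p1.
set B := [set x | (s <= `|u x|)%R] in Pu.
have mB : measurable B by exact: measurable_norm_ge.
have le_int : (\int[P]_x (`|(EFin \o u) x| `^ p) <= (k `^ p)%:E)%E.
  apply: (@le_trans _ _ (\int[P]_x (s `^ p + 2 `^ p * \1_B x)%:E)%E).
    apply: ge0_le_integral => //.
    - by move=> x _; exact: poweR_ge0.
    - apply: (@measurableT_comp _ _ _ _ _ _ (fun x => x `^ p)%E) => //.
        exact: measurable_poweR.
      by apply: measurableT_comp => //; exact/measurable_EFinP.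
    - apply: measurableT_comp => //; apply: measurable_funD => //.
      exact: measurable_funM.
    move=> x _; rewrite /= lee_fin.
    rewrite indicE; case: (boolP (x \in B)) => [_|].
      rewrite mulr1 ler_wpDl ?powR_ge0//.
      by apply: ge0_ler_powR; rewrite ?nnegrE//; exact: ltW.
    rewrite notin_setE /B/= => /negP; rewrite -ltNge => us.
    by rewrite mulr0 addr0; apply: ge0_ler_powR; rewrite ?nnegrE//; exact: ltW.
  under eq_integral do rewrite EFinD EFinM.
  rewrite ge0_integralD//=; last 2 first.
  - by move=> x _; rewrite lee_fin powR_ge0.
  - by apply: (@measurableT_comp _ _ _ _ _ _ EFin _ (fun x => 2 `^ p * \1_B x)) => //;
      exact: measurable_funM.
  rewrite integral_cst//= probability_setT mule1.
  rewrite ge0_integralZl_EFin ?powR_ge0//=; last first.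
    by apply/measurable_EFinP.
  rewrite integral_indic// setIT.
  apply: (@le_trans _ _ ((s `^ p)%:E + (2 `^ p)%:E * s%:E)%E).
    by rewrite leeD2l// lee_wpmul2l// lee_fin powR_ge0.
  rewrite -EFinM -EFinD lee_fin; apply: le_trans sk.
  by rewrite mulrDl mul1r lerD2r; apply: ge1r_powR; rewrite ?s0.
rewrite unlock; apply: le_trans (gt0_ler_poweR _ _ _ le_int) _.
- by rewrite invr_ge0 ltW.
- by rewrite in_itv/= leey andbT; apply: integral_ge0 => x _; rewrite lee_fin powR_ge0.
- by rewrite in_itv/= leey andbT lee_fin powR_ge0.
by rewrite poweR_EFin lee_fin -powRrM mulfV ?gt_eqF// powRr1.
Qed.

(** For finite [q], Markov's inequality bounds the probability by [t^q <= t]. For [q = +oo], the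
    essential bound [h * t < h] makes the event null. *)
Lemma prob_le_of_Lnorm (q : \bar R) (h t : R) (g : T -> R) :
  (1 < q)%E -> 0 < h -> 0 < t -> t < 1 -> measurable_fun setT g ->
  (Lnorm P q (EFin \o g) <= (h * t)%:E)%E ->
  (P [set x | (h <= `|g x|)%R] <= t%:E)%E.
Proof.
move=> + h0 t0 t1 mg.
have mB : measurable [set x | (h <= `|g x|)%R] by exact: measurable_norm_ge.
case: q => [q||//].
  rewrite lte_fin => q1 Lg.
  have q0 : 0 < q by exact: lt_trans q1.
  have mge : measurable_fun setT (EFin \o g) by exact/measurable_EFinP.
  have := @le_integral_comp_abse _ _ _ P _ measurableT _ h
    (fun x => x `^ q)%E (measurable_poweR q) _ _ mge h0.
  rewrite setTI -(poweR_Lnorm P (EFin \o g) (lt0r_neq0 q0)).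
  move=> /(_ (fun r _ => poweR_ge0 r q)) H.
  have {H} H : ((h `^ q)%:E * P [set x | (h <= `|g x|)%R] <=
      Lnorm P q%:E (EFin \o g) `^ q)%E.
    apply: H => x y; rewrite !inE/= !in_itv/= !andbT => x_ge0 y_ge0.
    by apply: gt0_ler_poweR; rewrite ?ltW// in_itv/= leey andbT.
  have ht0 : 0 <= h * t by rewrite mulr_ge0 ?ltW.
  have {H} : ((h `^ q)%:E * P [set x | (h <= `|g x|)%R] <=
      (h `^ q)%:E * (t `^ q)%:E)%E.
    rewrite -EFinM -(powRM _ (ltW h0) (ltW t0)); apply: (le_trans H).
    rewrite -[leRHS]poweR_EFin.
    apply: gt0_ler_poweR (ltW q0) _ _ _ _ Lg;
      by rewrite in_itv/= leey andbT ?Lnorm_ge0.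
  rewrite lee_pmul2l ?lte_fin ?powR_gt0// => H.
  apply: (le_trans H); rewrite lee_fin.
  by apply: ge1r_powR; rewrite ?t0 ltW.
move=> _; rewrite unlock/= probability_setT lte01 => /ess_sup_inf.ess_supP Lg.
rewrite (_ : P _ = 0%E) ?lee_fin ?ltW//.
apply: measure_negligible => //; apply: negligibleS Lg => x /= hg.
rewrite lee_fin; apply/negP; rewrite -ltNge.
by apply: lt_le_trans hg; rewrite gtr_pMr.
Qed.

End SmallInMeasure.

(** A bounded [u] that is small in measure is small in [L^p]; hence [A u] is small in [L^q], and so
    in measure. The threshold [s] is chosen before the space and the operator. *)
Lemma op_small_in_measure (p C h : R) (q : \bar R) :
  1 <= p -> (1 < q)%E -> 0 < h ->
  exists2 s : R, 0 < s & forall d (T : measurableType d) (P : probability T R) A,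
    P_operator P A -> opnorm_le P p%:E q C A ->
    forall u, Linf u -> (forall x, `|u x| <= 2) ->
    (P [set x | (s <= `|u x|)%R] <= s%:E)%E ->
    (P [set x | (h <= `|A u x|)%R] <= h%:E)%E.
Proof.
move=> p1 q1 h0.
pose t := Num.min h 1 / 2.
have m0 : 0 < Num.min h 1 by rewrite lt_min h0 ltr01.
have t0 : 0 < t by rewrite divr_gt0.
have mt : t < Num.min h 1 by rewrite ltr_pdivrMr// ltr_pMr// ltr1n.
have [th t1] : t < h /\ t < 1.
  by split; apply: lt_le_trans mt _; rewrite ge_min lexx ?orbT.
have C0 : 0 < `|C| + 1 by rewrite ltr_wpDl.
(* The [L^p] size that the operator turns into at most [h * t]; [|C| + 1] replaces [C], which need
   not be positive. *)
pose k := h * t / (`|C| + 1).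
have k0 : 0 < k by rewrite divr_gt0// mulr_gt0.
pose c := 1 + 2 `^ p : R.
have c0 : 0 < c by rewrite ltr_wpDr ?powR_ge0.
(* This gives [s <= 1] and [(1 + 2^p) * s <= k^p]. *)
exists (Num.min 1 (k `^ p / c)).
  by rewrite lt_min ltr01 divr_gt0 ?powR_gt0.
move=> d T P A [_ _ mA _] AC u Lu u2 Pu.
have Lpu : (Lnorm P p%:E (EFin \o u) <= k%:E)%E.
  apply: (Lnorm_le_of_prob p1 _ _ (ltW k0) _ Lu.1 u2 Pu).
  - by rewrite lt_min ltr01 divr_gt0 ?powR_gt0.
  - by rewrite ge_min lexx.
  - by rewrite mulrC -ler_pdivlMr// ge_min lexx orbT.
apply: (@le_trans _ _ t%:E); last by rewrite lee_fin ltW.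
apply: (prob_le_of_Lnorm q1 h0 t0 t1 (mA _ Lu)).
apply: (le_trans (AC _ Lu)).
apply: (@le_trans _ _ ((`|C| + 1)%:E * k%:E)%E); last first.
  by rewrite -EFinM lee_fin /k mulrC divfK// gt_eqF.
apply: (@le_trans _ _ ((`|C| + 1)%:E * Lnorm P p%:E (EFin \o u))%E).
  rewrite lee_wpmul2r ?Lnorm_ge0// lee_fin.
  by rewrite (le_trans (ler_norm _))// lerDl.
by rewrite lee_wpmul2l// lee_fin ltW.
Qed.

(** * Linear combinations under operators that are linear almost everywhere *)

Section Operators.
Context d (T : measurableType d) (P : probability T R).
Implicit Types (A : (T -> R) -> T -> R) (f g u v w : T -> R).

Lemma prob_norm_ge_ae f g h : measurable_fun setT f -> measurable_fun setT g ->
  {ae P, forall x, f x = g x} ->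
  (P [set x | (h <= `|f x|)%R] <= P [set x | (h <= `|g x|)%R])%E.
Proof.
move=> mf mg [N [mN N0 sN]].
have mF := measurable_norm_ge h mf; have mG := measurable_norm_ge h mg.
apply: (@le_trans _ _ (P ([set x | (h <= `|g x|)%R] `|` N))).
  apply: le_measure; rewrite ?inE//; first exact: measurableU.
  move=> x /= hf; have [fg|fg] := pselect (f x = g x).
    by left; rewrite -fg.
  by right; exact: sN.
have PN : P N = 0%E by exact: N0.
have GN : (P ([set x | (h <= `|g x|)%R] `|` N) <=
  P [set x | (h <= `|g x|)%R] + P N)%E by exact: measureU2.
by rewrite PN adde0 in GN.
Qed.

Lemma prob_dist_ge_ae f g h : 0 < h ->
  measurable_fun setT f -> measurable_fun setT g ->
  {ae P, forall x, f x = g x} ->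
  (P [set x | (h <= `|f x - g x|)%R] <= h%:E)%E.
Proof.
move=> h0 mf mg fg.
apply: (@le_trans _ _ (P [set x | (h <= `|cst 0 x : R|)%R])).
  apply: prob_norm_ge_ae => //; first exact: measurable_funB.
  by apply: filterS fg => x ->; rewrite subrr.
rewrite (_ : [set x | _] = set0) ?measure0 ?lee_fin ?ltW//.
by apply/seteqP; split => x //=; rewrite normr0 leNgt h0.
Qed.

Lemma Linf_lin v w (a b : R) : Linf v -> Linf w ->
  Linf (fun x => a * v x + b * w x).
Proof.
move=> [mv [M vM]] [mw [N wN]]; split.
  by apply: measurable_funD; exact: measurable_funM.
exists (`|a| * M + `|b| * N) => x.
by rewrite (le_trans (ler_normD _ _))// !normrM lerD// ler_wpM2l.
Qed.

Lemma Linf0 : Linf (fun _ : T => 0 : R).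
Proof. by split=> //; exists 0 => x; rewrite normr0. Qed.

Section LinearCombination.
Context (I : eqType) (c : I -> R) (u : I -> T -> R).
Hypothesis Lu : forall i, Linf (u i).

Lemma Linf_sum (s : seq I) : Linf (fun x => \sum_(i <- s) c i * u i x).
Proof.
elim: s => [|i s IH].
  by under eq_fun do rewrite big_nil; exact: Linf0.
under eq_fun do rewrite big_cons -[X in _ + X]mul1r.
exact: Linf_lin.
Qed.

Lemma op_sum_ae A (s : seq I) : P_operator P A ->
  {ae P, forall x, A (fun y => \sum_(i <- s) c i * u i y) x =
                   \sum_(i <- s) c i * A (u i) x}.
Proof.
move=> [linA _ _ _]; elim: s => [|i s IH].
  (* Zero coefficients in the linearity axiom show that the image of 0 vanishes almost
     everywhere. *)
  have := linA _ _ 0 0 Linf0 Linf0.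
  rewrite (_ : (fun y => _) = (fun y => \sum_(i <- [::]) c i * u i y)).
    by apply: filterS => x ->; rewrite big_nil !mul0r addr0.
  by apply/funext => y; rewrite big_nil !mul0r addr0.
have := linA _ _ (c i) 1 (Lu i) (Linf_sum s).
rewrite (_ : (fun y => _) = (fun y => \sum_(i <- i :: s) c i * u i y)).
  by apply: filterS2 IH => x IH ->; rewrite big_cons mul1r IH.
by apply/funext => y; rewrite big_cons mul1r.
Qed.

End LinearCombination.

Lemma jointv_measurable k A (v : 'I_k -> T -> R) :
  P_operator P A -> (forall a, Linf (v a)) -> coord_measurable (jointv A v).
Proof.
move=> [_ _ mA _] Lv j; rewrite /jointv; case: fintype.split => a.
  by have [] := Lv a.
exact: mA.
Qed.

Lemma adm_S_Linf k (v : 'I_k -> T -> R) a : adm_S v -> Linf (v a).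
Proof. by move=> /(_ a)[mv v1]; split => //; exists 1. Qed.

Lemma adm_S'_S k (v : 'I_k -> T -> R) : adm_S' v -> adm_S v.
Proof.
move=> [v01 _] a; have [mv v0] := v01 a; split => // x.
by case: (v0 x) => ->; rewrite ?normr0 ?normr1.
Qed.

(** The values of a partition at a point are nonnegative with sum 1, so a bound on the coefficients
    passes to the combination. *)
Lemma adm_S_lincomb k K (c : 'I_k -> 'I_K -> R) (u : 'I_K -> T -> R) :
  (forall a i, `|c a i| <= 1) -> adm_S' u ->
  adm_S (fun a x => \sum_(i < K) c a i * u i x).
Proof.
move=> c1 u' a; split; first by have [] := Linf_sum (c a)
  (fun i => adm_S_Linf i (adm_S'_S u')) (index_enum 'I_K).
move=> x; have [u01 /(_ x) <-] := u'.
apply: le_trans (ler_norm_sum _ _ _) _; apply: ler_sum => i _; rewrite normrM.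
have [_ /(_ x)[]->] := u01 i; first by rewrite normr0 mulr0.
by rewrite normr1 mulr1.
Qed.

End Operators.

(** * Stability of joint distributions under perturbations and linear combinations *)

(** The function coordinates are close by hypothesis, the image coordinates by [op_small_in_measure]
    applied to [v a - w a], which is bounded by 2; [LP_close_coupling] combines them. *)
Lemma jointv_perturb (p C : R) (q : \bar R) k (e : R) :
  1 <= p -> (1 < q)%E -> (0 < k)%N -> 0 < e ->
  exists2 s : R, 0 < s & forall d (T : measurableType d) (P : probability T R) A,
    P_operator P A -> opnorm_le P p%:E q C A ->
    forall v w : 'I_k -> T -> R, adm_S v -> adm_S w ->
    (forall a, (P [set x | (s <= `|v a x - w a x|)%R] <= s%:E)%E) ->
    LP_close P (jointv A v) P (jointv A w) e.
Proof.
move=> p1 q1 k0 e0.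
have kk0 : 0 < (k + k)%:R :> R by rewrite ltr0n addn_gt0 k0.
(* The coupling costs a factor equal to the number [k + k] of coordinates. *)
pose h := e / (k + k)%:R; have h0 : 0 < h by rewrite divr_gt0.
have [s s0 As] := op_small_in_measure C p1 q1 h0.
(* [s] controls the images and [h] the functions themselves. *)
exists (Num.min s h); first by rewrite lt_min s0.
move=> d T P A PA AC v w av aw vw.
have Lv a := adm_S_Linf a av; have Lw a := adm_S_Linf a aw.
have mvw a : measurable_fun setT (fun x => v a x - w a x).
  by apply: measurable_funB; [case: (Lv a)|case: (Lw a)].
have {}vw a t : Num.min s h <= t ->
    (P [set x | (t <= `|v a x - w a x|)%R] <= t%:E)%E.
  move=> st; apply: (@le_trans _ _ (Num.min s h)%:E); last by rewrite lee_fin.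
  apply: le_trans (vw a); apply: le_measure; rewrite ?inE.
  - exact: measurable_norm_ge.
  - exact: measurable_norm_ge.
  - by move=> x /=; exact: le_trans.
have -> : e = (k + k)%:R * h by rewrite mulrC divfK// gt_eqF.
apply: LP_close_coupling.
- by rewrite addn_gt0 k0.
- exact: (jointv_measurable PA).
- exact: (jointv_measurable PA).
move=> j; rewrite /jointv; case: fintype.split => a.
  by apply: vw; rewrite ge_min lexx orbT.
pose u x := 1 * v a x + (-1) * w a x.
have uE x : u x = v a x - w a x by rewrite /u mul1r mulN1r.
have Lu : Linf u by exact: Linf_lin.
have [linA _ mA _] := PA.
apply: (@le_trans _ _ (P [set x | (h <= `|A u x|)%R])).
  apply: prob_norm_ge_ae; [|exact: mA|].
    by apply: measurable_funB; exact: mA.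
  by apply: filterS (linA _ _ 1 (-1) (Lv a) (Lw a)) => x ->; rewrite mul1r mulN1r.
apply: (As _ _ _ _ PA AC) => // [x|].
  rewrite uE (le_trans (ler_normB _ _))//.
  by rewrite -[2]/(1 + 1) lerD//; [case: (av a)|case: (aw a)].
rewrite (_ : [set x | _] = [set x | (s <= `|v a x - w a x|)%R]).
  by apply: vw; rewrite ge_min lexx.
by apply/seteqP; split => x /=; rewrite uE.
Qed.

(** The matrix [c] acting alike on both halves of a joint vector, the functions and their images. *)
Definition block_lincomb k K (c : 'I_k -> 'I_K -> R) (x : 'I_(K + K) -> R) :
    'I_(k + k) -> R :=
  fun j => match fintype.split j with
           | inl a => \sum_(i < K) c a i * x (lshift K i)
           | inr a => \sum_(i < K) c a i * x (rshift K i)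
           end.

Lemma block_lincomb_lip k K (c : 'I_k -> 'I_K -> R) x y :
  (forall a i, `|c a i| <= 1) ->
  dist2 (block_lincomb c x) (block_lincomb c y) <= ((k + k) * K)%:R * dist2 x y.
Proof.
move=> c1; apply: le_trans (ler_dist2_sum _ _) _.
have h (z : 'I_K -> 'I_(K + K)) a :
    `|\sum_(i < K) c a i * x (z i) - \sum_(i < K) c a i * y (z i)| <=
    K%:R * dist2 x y.
  rewrite -sumrB (le_trans (ler_norm_sum _ _ _))//.
  rewrite mulr_natl -[X in _ *+ X]card_ord -sumr_const; apply: ler_sum => i _.
  rewrite -mulrBr normrM (le_trans _ (ler_coord_dist2 x y (z i)))//.
  by rewrite ler_piMl.
rewrite natrM -mulrA mulr_natl -[X in _ *+ X]card_ord -sumr_const.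
by apply: ler_sum => j _; rewrite /block_lincomb; case: fintype.split => a; exact: h.
Qed.

(** The two vectors agree exactly on the function half and, by linearity, almost everywhere on the
    image half; hence closeness for every positive [e]. *)
Lemma jointv_lincomb_close d (T : measurableType d) (P : probability T R) A
    k K (c : 'I_k -> 'I_K -> R) (u : 'I_K -> T -> R) e :
  P_operator P A -> (forall i, Linf (u i)) -> (0 < k)%N -> 0 < e ->
  LP_close P (jointv A (fun a x => \sum_(i < K) c a i * u i x))
           P (fun x => block_lincomb c (jointv A u x)) e.
Proof.
move=> PA Lu k0 e0; have [_ _ mA _] := PA.
have kk0 : 0 < (k + k)%:R :> R by rewrite ltr0n addn_gt0 k0.
have Lc a : Linf (fun x => \sum_(i < K) c a i * u i x) by exact: Linf_sum.
have -> : e = (k + k)%:R * (e / (k + k)%:R) by rewrite mulrC divfK// gt_eqF.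
have mj := jointv_measurable PA Lu.
apply: LP_close_coupling.
- by rewrite addn_gt0 k0.
- exact: (jointv_measurable PA).
- move=> j; rewrite /block_lincomb; case: fintype.split => a;
    by apply: measurable_sum => i; apply: measurable_funM => //; exact: mj.
move=> j; rewrite /jointv /block_lincomb; case: fintype.split => a.
  rewrite (_ : [set x | _] = set0) ?measure0 ?lee_fin ?divr_ge0 ?ltW//.
  apply/seteqP; split => x //=; under [X in _ - X]eq_bigr do rewrite (unsplitK (inl _)).
  by rewrite subrr normr0 leNgt divr_gt0.
apply: prob_dist_ge_ae; [by rewrite divr_gt0|exact: mA| |].
  apply: measurable_sum => i; apply: measurable_funM => //.
  by under eq_fun do rewrite (unsplitK (inr _)); exact: mA.
apply: filterS (op_sum_ae (c a) Lu (index_enum 'I_K) PA) => x ->.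
by apply: eq_bigr => i _; rewrite (unsplitK (inr _)).
Qed.

(** * Function partitions from finitely many measurable tests *)

(** The set is a finite union, over the test outcomes that [g] sends to [i], of finite intersections
    of sets [D f] and complements. *)
Lemma measurable_decision d (T : measurableType d) (F : finType) (J : Type)
    (D : F -> set T) (g : {ffun F -> bool} -> J) (i : J) :
  (forall f, measurable (D f)) ->
  measurable [set x | g [ffun f => `[< D f x >]] = i].
Proof.
move=> mD.
have -> : [set x | g [ffun f => `[< D f x >]] = i] =
    \bigcup_(b in [set b | g b = i])
      \bigcap_(f in [set: F]) (if b f then D f else ~` D f).
  apply/seteqP; split => [x gx|x [b gb bx]] /=.
    exists [ffun f => `[< D f x >]] => // f _; rewrite ffunE.
    by case: asboolP.
  rewrite -gb; congr g; apply/ffunP => f; rewrite ffunE; have := bx f I.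
  by case: (b f) => Dx; [exact/asboolP|exact/asboolPn].
apply: fin_bigcup_measurable => // b _; apply: fin_bigcap_measurable => // f _.
by case: (b f) => //; exact: measurableC.
Qed.

Definition class_indicator d (T : measurableType d) K (c : T -> 'I_K) (j : 'I_K)
  (x : T) : R := (c x == j)%:R.

Lemma adm_S'_class_indicator d (T : measurableType d) K (c : T -> 'I_K) :
  (forall j, measurable [set x | c x = j]) -> adm_S' (class_indicator c).
Proof.
move=> mc; split=> [j|x].
  split=> [|x]; last by rewrite /class_indicator; case: eqP; [right|left].
  rewrite (_ : class_indicator c j = \1_[set x | c x = j]).
    exact: measurable_indic.
  apply/funext => x; rewrite /class_indicator indicE; congr ((nat_of_bool _)%:R).
  by apply/idP/idP => [/eqP|]; rewrite inE// => /eqP.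
rewrite (bigD1 (c x))//= /class_indicator eqxx big1 ?addr0// => j.
by rewrite eq_sym => /negbTE ->.
Qed.

(** Equally spaced points from -1 to 1 with step [1/(m+1)]; both ends are included, hence the outer
    successor. *)
Definition grid m (j : 'I_(m.+1 * 2).+1) : R := j%:R / m.+1%:R - 1.

Lemma grid_bound m (j : 'I_(m.+1 * 2).+1) : `|grid j| <= 1.
Proof.
rewrite /grid ler_norml lerBrDr addNr lerBlDr divr_ge0//=.
by rewrite ler_pdivrMr// -[1 + 1]/2%:R -natrM ler_nat (mulnC 2) -ltnS.
Qed.

Lemma grid_approx m (t : R) : `|t| <= 1 ->
  exists j : 'I_(m.+1 * 2).+1, `|t - grid j| <= m.+1%:R^-1.
Proof.
rewrite ler_norml => /andP[t1 t2].
have m0 : 0 < m.+1%:R :> R by rewrite ltr0n.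
have y0 : 0 <= (t + 1) * m.+1%:R by rewrite mulr_ge0// -lerBlDr sub0r.
(* The integer part of [(t + 1) * (m + 1)] indexes the last grid point not above [t]. *)
have /andP[j1 j2] := truncn_itv y0.
set j := Num.truncn _ in j1 j2.
have jm : (j < (m.+1 * 2).+1)%N.
  rewrite ltnS -(ler_nat R) (le_trans j1)// natrM mulrC ler_wpM2l//.
  by rewrite -[2]/(1 + 1) lerD2r.
exists (Ordinal jm); rewrite /grid/= opprB addrA.
have -> : t + 1 - j%:R / m.+1%:R = ((t + 1) * m.+1%:R - j%:R) / m.+1%:R.
  by rewrite mulrBl mulfK// gt_eqF.
rewrite normrM [X in _ * X]gtr0_norm ?invr_gt0// ler_piMl ?invr_ge0//.
by rewrite ger0_norm ?subr_ge0// lerBlDl natr1 ltW.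
Qed.

(* The classes are the preimages of the points of a finite grid in [[-1, 1]^k]:
   a family of [k] functions becomes, up to [s], a fixed linear combination of a
   function partition. *)
Lemma adm_S_discretize k (s : R) : 0 < s ->
  exists K (c : 'I_k -> 'I_K -> R), [/\ (0 < K)%N, forall a i, `|c a i| <= 1 &
    forall d (T : measurableType d) (v : 'I_k -> T -> R), adm_S v ->
    exists2 u : 'I_K -> T -> R, adm_S' u &
      forall a x, `|v a x - \sum_(i < K) c a i * u i x| < s].
Proof.
move=> s0; have [m] := ltr_add_invr s0; rewrite add0r => ms.
pose I := {ffun 'I_k -> 'I_(m.+1 * 2).+1}.
(* Classes are indexed by the points of the [k]-dimensional grid; [c a i] is coordinate [a] of point
   [i]. *)
exists #|{: I}|, (fun a i => grid ((enum_val i : I) a)); split.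
- by apply/card_gt0P; exists [ffun=> ord0].
- by move=> a i; exact: grid_bound.
move=> d T v av.
pose D (f : 'I_k * 'I_(m.+1 * 2).+1) :=
  [set x | `|v f.1 x - grid f.2| <= m.+1%:R^-1].
(* The default [ord0] is never taken at the outcomes of actual points, by [grid_approx]. *)
pose g (b : {ffun 'I_k * 'I_(m.+1 * 2).+1 -> bool}) : I :=
  [ffun a => odflt ord0 [pick j | b (a, j)]].
pose c x := enum_rank (g [ffun f => `[< D f x >]]).
have mD f : measurable (D f).
  have [mv _] := av f.1.
  have mvf : measurable_fun setT (fun x => v f.1 x - grid f.2).
    exact: measurable_funB.
  rewrite (_ : D f = (fun x => `|v f.1 x - grid f.2|) @^-1` `]-oo, m.+1%:R^-1]%classic).
    rewrite -[X in measurable X]setTI.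
    have := measurableT_comp (@normr_measurable R setT) mvf.
    by apply=> //; exact: measurable_itv.
  by apply/seteqP; split => x /=; rewrite in_itv.
exists (class_indicator c).
  apply: adm_S'_class_indicator => j.
  exact: (@measurable_decision _ _ _ _ D (fun b => enum_rank (g b))).
move=> a x; rewrite (bigD1 (c x))//= big1 ?addr0 => [|j]; last first.
  by rewrite /class_indicator eq_sym => /negbTE ->; rewrite mulr0.
rewrite /class_indicator eqxx mulr1 /c enum_rankK ffunE.
apply: le_lt_trans ms; case: pickP => [j|/=].
  by rewrite ffunE => /asboolP.
have [j hj] := grid_approx m (proj2 (av a) x).
by move=> /(_ j); rewrite ffunE => /asboolP; case.
Qed.

(** A point goes to the class of some coordinate exceeding 1/2; within 1/2 of the vertex [b], only
    coordinate [b] qualifies. *)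
Lemma adm_S_round k d (T : measurableType d) (w : 'I_k -> T -> R) :
  (0 < k)%N -> adm_S w ->
  exists2 w' : 'I_k -> T -> R, adm_S' w' & forall x b,
    (forall a, `|w a x - (a == b)%:R| < 2^-1) ->
    forall a, w' a x = (a == b)%:R.
Proof.
move=> k0 aw.
pose D a := [set x | 2^-1 < w a x].
(* The default class receives the points where no coordinate exceeds 1/2, so that the classes cover
   the space. *)
pose g (b : {ffun 'I_k -> bool}) := odflt (Ordinal k0) [pick a | b a].
pose c x := g [ffun a => `[< D a x >]].
have mD a : measurable (D a).
  have [mw _] := aw a.
  rewrite (_ : D a = w a @^-1` `]2^-1, +oo[%classic).
    by rewrite -[X in measurable X]setTI; apply: mw => //; exact: measurable_itv.
  by apply/seteqP; split => x /=; rewrite in_itv/= andbT.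
exists (class_indicator c).
  by apply: adm_S'_class_indicator => j; exact: measurable_decision.
move=> x b wb a; rewrite /class_indicator eq_sym; congr ((_ == _)%:R).
rewrite /c /g; case: pickP => [j|]/=.
  rewrite ffunE => /asboolP; rewrite /D/=; have := wb j.
  have [//|_] := eqVneq j b; rewrite subr0 => h1 h2.
  by have := lt_trans h2 (le_lt_trans (ler_norm _) h1); rewrite ltxx.
move=> /(_ b); rewrite ffunE => /asboolP; rewrite /D/= => h.
have := wb b; rewrite eqxx distrC => /(le_lt_trans (ler_norm _)) h2.
by exfalso; apply: h; move: h2; rewrite mulr1n; lra.
Qed.

(** * Transfer between partitions and [[-1, 1]]-valued families *)

Section Comparison.
Variables (p C : R) (q : \bar R).
Hypotheses (p1 : 1 <= p) (q1 : (1 < q)%E).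

Definition op_in_class d (T : measurableType d) (P : probability T R) A :=
  P_operator P A /\ opnorm_le P p%:E q C A.

(** Off an event of probability at most [r], the values of [w] lie within [2 * r] of a vertex, to
    which [w'] rounds them. *)
Lemma approx_S'_of_S k (e : R) : (0 < k)%N -> 0 < e ->
  exists2 r : R, 0 < r & forall d1 d2 (T1 : measurableType d1)
    (T2 : measurableType d2) (P1 : probability T1 R) (P2 : probability T2 R) A1 A2,
    op_in_class P1 A1 -> op_in_class P2 A2 ->
    forall (v : 'I_k -> T1 -> R) (w : 'I_k -> T2 -> R), adm_S' v -> adm_S w ->
    LP_close P1 (jointv A1 v) P2 (jointv A2 w) r ->
    exists2 w' : 'I_k -> T2 -> R, adm_S' w' &
      LP_close P1 (jointv A1 v) P2 (jointv A2 w') e.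
Proof.
move=> k0 e0; have e20 : 0 < e / 2 by rewrite divr_gt0.
have [s s0 hs] := jointv_perturb C p1 q1 k0 e20.
(* [e / 2] serves the triangle inequality, [2 * r <= s] the perturbation bound and [2 * r <= 1/2]
   the rounding. *)
pose r := Num.min (e / 2) (Num.min (s / 2) 4^-1).
have r0 : 0 < r by rewrite !lt_min e20 divr_gt0//= invr_gt0.
have re : r <= e / 2 by rewrite ge_min lexx.
have rs : r <= s / 2 by rewrite !ge_min lexx orbT.
have r4 : r <= 4^-1 by rewrite !ge_min lexx !orbT.
exists r => // d1 d2 T1 T2 P1 P2 A1 A2 [PA1 _] [PA2 AC2] v w av aw vw.
have [w' aw' ww'] := adm_S_round k0 aw.
have mv := jointv_measurable PA1 (fun a => adm_S_Linf a (adm_S'_S av)).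
have mw := jointv_measurable PA2 (fun a => adm_S_Linf a aw).
have mw' := jointv_measurable PA2 (fun a => adm_S_Linf a (adm_S'_S aw')).
exists w' => //.
suff c : LP_close P2 (jointv A2 w) P2 (jointv A2 w') (e / 2).
  have := LP_close_trans mv mw' vw c; apply: LP_close_le => //.
  by rewrite [leRHS]splitr lerD2r.
apply: hs => //; first exact: adm_S'_S.
(* [V] consists of the points whose first half is a vertex of the simplex; it is
   thickened once so as to be open, hence Borel. *)
pose V := [set z : 'I_(k + k) -> R | exists b, forall a, z (lshift k a) = (a == b)%:R].
pose G := jointv A2 w @^-1` fatten (fatten V r) r.
have mG : measurable G by exact: measurable_fatten.
have vV : jointv A1 v @^-1` fatten V r = setT.
  apply/seteqP; split => // x _; apply: sub_fatten => //.
  have [v01 v1] := av.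
  have [b vb] : exists b, v b x = 1.
    apply: contrapT => /forallNP h; have := v1 x; rewrite big1 => [/eqP|a _].
      by rewrite eq_sym oner_eq0.
    by have [_ /(_ x)[//|/h]] := v01 a.
  exists b => a; rewrite /jointv (unsplitK (inl _)).
  have [->//|ab] := eqVneq a b; have [_ /(_ x)[//|va]] := v01 a.
  (* A second function equal to 1 at [x] would push the sum to at least 2. *)
  have : 1 + 1 <= \sum_(a < k) v a x :> R.
    rewrite (bigD1 b)//= (bigD1 a)//= vb va lerD2l lerDl sumr_ge0// => i _.
    by have [_ /(_ x)[]->] := v01 i.
  by rewrite v1 gerDl ler10.
have PG : (P2 (~` G) <= r%:E)%E.
  (* The first joint vector is always in the thickening of [V], so the second is in its thickening
     [G] with probability at least [1 - r]. *)
  have [+ _] := vw _ (BorelE_openE (openE_fatten (U := V) (e := r))).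
  rewrite vV !probability_setT probability_setC// => h.
  by rewrite leeBlDl; [exact: h|exact: fin_num_measure].
move=> a; apply: (@le_trans _ _ r%:E); last first.
  by rewrite lee_fin (le_trans rs)// ler_pdivrMr// ler_pMr// ler1n.
apply: le_trans PG; apply: le_measure; rewrite ?inE.
- apply: measurable_norm_ge; apply: measurable_funB; first by have [] := aw a.
  by have [/(_ a)[]] := aw'.
- exact: measurableC.
(* At a point of [G], [w] is within [2 * r <= s] of the vertex [w'], contradicting [sx]. *)
move=> x /= sx /fatten_fatten [z [b zb] xz].
have near a' : `|w a' x - (a' == b)%:R| < r + r.
  have := le_lt_trans (ler_coord_dist2 _ _ (lshift k a')) xz.
  by rewrite zb /jointv (unsplitK (inl _)).
have : s <= `|w a x - (a == b)%:R|.
  rewrite -(ww' x b)// => a'; apply: lt_le_trans (near a') _; lra.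
by have := near a; lra.
Qed.

(** The discretisation fixes [K] and the coefficients before the operators, so matching partitions
    into this one number of classes suffices. *)
Lemma approx_S_of_S' k (e : R) : (0 < k)%N -> 0 < e ->
  exists K (r : R), [/\ (0 < K)%N, 0 < r & forall d1 d2 (T1 : measurableType d1)
    (T2 : measurableType d2) (P1 : probability T1 R) (P2 : probability T2 R) A1 A2,
    op_in_class P1 A1 -> op_in_class P2 A2 ->
    (forall u : 'I_K -> T1 -> R, adm_S' u -> exists2 w : 'I_K -> T2 -> R,
       adm_S' w & LP_close P1 (jointv A1 u) P2 (jointv A2 w) r) ->
    forall v : 'I_k -> T1 -> R, adm_S v -> exists2 w : 'I_k -> T2 -> R,
       adm_S w & LP_close P1 (jointv A1 v) P2 (jointv A2 w) e].
Proof.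
move=> k0 e0; have e40 : 0 < e / 4 by rewrite divr_gt0.
have [s s0 hs] := jointv_perturb C p1 q1 k0 e40.
have [K [c [K0 c1 hc]]] := adm_S_discretize k s0.
pose L : R := ((k + k) * K)%:R.
have L1 : 1 <= L by rewrite ler1n muln_gt0 addn_gt0 k0 K0.
have L0 : 0 < L by exact: lt_le_trans L1.
(* The [L]-Lipschitz block map enlarges this radius to [e / 4]. *)
exists K, (e / 4 / L); split => //; first exact: divr_gt0.
move=> d1 d2 T1 T2 P1 P2 A1 A2 [PA1 AC1] [PA2 AC2] h v av.
have [u au vu] := hc _ _ v av.
have [w aw uw] := h u au.
have Lu a := adm_S_Linf a (adm_S'_S au).
have Lw a := adm_S_Linf a (adm_S'_S aw).
pose comb d (T : measurableType d) (f : 'I_K -> T -> R) a x :=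
  \sum_(i < K) c a i * f i x.
have avu : adm_S (comb _ _ u) by exact: adm_S_lincomb.
have aww : adm_S (comb _ _ w) by exact: adm_S_lincomb.
exists (comb _ _ w) => //.
have mblock d (T : measurableType d) (X : T -> 'I_(K + K) -> R) :
    coord_measurable X -> coord_measurable (fun x => block_lincomb c (X x)).
  move=> mX j; rewrite /block_lincomb; case: fintype.split => a;
    by apply: measurable_sum => i; apply: measurable_funM => //; exact: mX.
have mju := jointv_measurable PA1 Lu; have mjw := jointv_measurable PA2 Lw.
have mv := jointv_measurable PA1 (fun a => adm_S_Linf a av).
have mww := jointv_measurable PA2 (fun a => adm_S_Linf a aww).
have c12 : LP_close P1 (jointv A1 v) P1 (jointv A1 (comb _ _ u)) (e / 4).
  apply: hs => // a; rewrite (_ : [set x | _] = set0) ?measure0 ?lee_fin ?ltW//.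
  by apply/seteqP; split => x //=; rewrite leNgt vu.
have c23 := jointv_lincomb_close c PA1 Lu k0 e40.
have c34 : LP_close P1 (fun x => block_lincomb c (jointv A1 u x))
    P2 (fun x => block_lincomb c (jointv A2 w x)) (e / 4).
  rewrite -[e / 4](divfK (lt0r_neq0 L0)) mulrC.
  apply: LP_close_image uw => //; try exact: mblock.
    by rewrite divr_ge0// ltW.
  by move=> x y; exact: block_lincomb_lip.
have c45 := LP_close_sym (jointv_lincomb_close c PA2 Lw k0 e40).
(* The four steps: discretise [v], pass to the block image of [u], cross to that of [w], return to
   the joint vector of the combination. *)
have -> : e = e / 4 + e / 4 + e / 4 + e / 4 by lra.
apply: LP_close_trans c45 => //.
apply: LP_close_trans c34 => //; first exact: mblock.
by apply: LP_close_trans c23 => //; exact: mblock.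
Qed.

End Comparison.

End LevyProkhorov.

(** * Equivalence of the two Cauchy conditions *)

Unset Implicit Arguments.
Set Strict Implicit.

Theorem theorem7p6 (R : realType) (p : R) (q : \bar R)
  (hp : 1 <= p) (hq : (1%E < q)%E)
  (dd : nat -> measure_display) (Om : forall i, measurableType (dd i))
  (P : forall i, probability (Om i) R) (A : forall i, (Om i -> R) -> (Om i -> R))
  (hA : forall i, P_operator (P i) (A i))
  (hbd : exists C : R, forall i, opnorm_le (P i) p%:E q C (A i)) :
  action_convergent P A <-> partition_convergent P A.
Proof.
have [C AC] := hbd.
have cl i : op_in_class p C q (P i) (A i) by split.
rewrite /action_convergent /partition_convergent !dH_cauchyP; last 2 first.
- move=> i k v av; apply: jointv_measurable (hA i) _ => a.
  exact: adm_S_Linf (adm_S'_S av).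
- by move=> i k v av; apply: jointv_measurable (hA i) _ => a; exact: adm_S_Linf.
split=> h k k0 e e0.
  have [r r0 hr] := approx_S'_of_S C hp hq k0 e0.
  have [N hN] := h k k0 r r0; exists N => i j Ni Nj v av.
  have [w aw c] := hN i j Ni Nj v (adm_S'_S av).
  exact: (hr _ _ _ _ _ _ _ _ (cl i) (cl j) _ _ av aw c).
(* Here the hypothesis is used at the number [K] of grid classes instead of [k]. *)
have [K [r [K0 r0 hr]]] := approx_S_of_S' C hp hq k0 e0.
have [N hN] := h K K0 r r0; exists N => i j Ni Nj.
exact: (hr _ _ _ _ _ _ _ _ (cl i) (cl j) (hN i j Ni Nj)).
Qed.
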